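(* Let $R$ be a commutative ring. Let $(\mathcal{C}_i)_{i \in \Gamma}$ and $(\mathcal{D}_j)_{j \in \Lambda}$ be families of connected triangulated $R$-categories, indexed by sets $\Gamma$ and $\Lambda$. Suppose there is an equivalence of triangulated $R$-categories $$\Phi \colon \bigoplus_{i \in \Gamma}\mathcal{C}_i \xrightarrow{\ \cong\ } \bigoplus_{j \in \Lambda}\mathcal{D}_j .$$ Then there is a bijective function $\pi \colon \Gamma \to \Lambda$ such that for every $i \in \Gamma$ there is an equivalence $\mathcal{C}_i \cong \mathcal{D}_{\pi(i)}$ of triangulated $R$-categories.
   Context: All additive categories are $R$-categories (i.e. $R$-linear: Hom sets are $R$-modules and composition is $R$-bilinear), and in a triangulated category $\operatorname{Hom}(X,Y)$ is a set for all objects $X,Y$. Direct sum: for triangulated $R$-categories $\mathcal{C},\mathcal{D}$, the category $\mathcal{C}\oplus\mathcal{D}$ has as objects the direct sums $U\oplus V$ with $U\in\mathcal{C}$, $V\in\mathcal{D}$, and morphisms $\operatorname{Hom}(U_1\oplus V_1,U_2\oplus V_2)=\operatorname{Hom}_{\mathcal{C}}(U_1,U_2)\oplus\operatorname{Hom}_{\mathcal{D}}(V_1,V_2)$. The shift is componentwise, and a sequence is a distinguished triangle iff its $\mathcal{C}$-component and its $\mathcal{D}$-component are distinguished triangles. For an arbitrary family $(\mathcal{C}_i)_{i\in\Gamma}$, $\bigoplus_{i\in\Gamma}\mathcal{C}_i$ is defined analogously; its objects are finite direct sums of objects of the $\mathcal{C}_i$ (i.e. families with only finitely many non-zero components), and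 there are no non-zero morphisms between objects of different $\mathcal{C}_i$. A triangulated category $\mathcal{C}$ is connected if (1) $\mathcal{C}\neq 0$ and (2) whenever $\mathcal{C}=\mathcal{C}_1\oplus\mathcal{C}_2$ with $\mathcal{C}_1,\mathcal{C}_2$ triangulated (sub)categories, then $\mathcal{C}_1=0$ or $\mathcal{C}_2=0$. Here, for full triangulated subcategories $\mathcal{C}_1,\mathcal{C}_2$ of $\mathcal{C}$ (closed under isomorphism), $\mathcal{C}=\mathcal{C}_1\oplus\mathcal{C}_2$ means that every object of $\mathcal{C}$ is isomorphic to $U\oplus V$ with $U\in\mathcal{C}_1$, $V\in\mathcal{C}_2$, and that all morphisms in $\mathcal{C}$ between objects of $\mathcal{C}_1$ and objects of $\mathcal{C}_2$ (in either direction) are zero. *)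

(* Defs.v *)
From HB Require Import structures.
From mathcomp Require Import all_boot all_algebra.
From mathcomp Require Import boolp classical_sets functions cardinality.

Set Implicit Arguments.
Unset Strict Implicit.
Unset Printing Implicit Defensive.

Import GRing.Theory.
Local Open Scope ring_scope.

Reserved Notation "g \oc f" (at level 40, left associativity).

Record rcat (R : comPzRingType) := RCat {
  ob :> Type;
  hom : ob -> ob -> lmodType R;
  idm : forall X, hom X X;
  comp : forall X Y Z, hom Y Z -> hom X Y -> hom X Z;
  comp1m : forall X Y (f : hom X Y), comp (idm Y) f = f;
  compm1 : forall X Y (f : hom X Y), comp f (idm X) = f;
  compA : forall X Y Z W (h : hom Z W) (g : hom Y Z) (f : hom X Y),
    comp h (comp g f) = comp (comp h g) f;
  comp_linearr : forall X Y Z (g : hom Y Z),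
    linear (fun f : hom X Y => comp g f);
  comp_linearl : forall X Y Z (f : hom X Y),
    linear (fun g : hom Y Z => comp g f)
}.

Arguments hom {R r} X Y.
Arguments idm {R r} X.
Arguments comp {R r X Y Z} g f.

Notation "g \oc f" := (comp g f) : ring_scope.

Section RCatNotions.
Context {R : comPzRingType} {C : rcat R}.

Definition is_iso (X Y : C) (f : hom X Y) : Prop :=
  exists g : hom Y X, g \oc f = idm X /\ f \oc g = idm Y.

Definition isomorphic (X Y : C) : Prop := exists f : hom X Y, is_iso f.

(* initial and terminal; uniqueness of a morphism is being the zero one *)
Definition is_zero (X : C) : Prop :=
  forall Y : C, (forall f : hom X Y, f = 0) /\ (forall f : hom Y X, f = 0).

(* B is a biproduct U (+) V *)
Definition is_biproduct (B U V : C) : Prop :=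
  exists (i1 : hom U B) (i2 : hom V B) (p1 : hom B U) (p2 : hom B V),
    [/\ p1 \oc i1 = idm U, p2 \oc i2 = idm V, p1 \oc i2 = 0, p2 \oc i1 = 0
      & i1 \oc p1 + i2 \oc p2 = idm B].

End RCatNotions.

Record rfun (R : comPzRingType) (C D : rcat R) := RFun {
  fob :> C -> D;
  fmor : forall X Y : C, {linear hom X Y -> hom (fob X) (fob Y)};
  fmor1 : forall X : C, fmor X X (idm X) = idm (fob X);
  fmorM : forall (X Y Z : C) (g : hom Y Z) (f : hom X Y),
    fmor X Z (g \oc f) = fmor Y Z g \oc fmor X Y f
}.

Arguments fmor {R C D} r {X Y}.

(* quasi-inverse, unit and counit; no triangle identity is required *)
Definition is_equivalence (R : comPzRingType) (C D : rcat R) (F : rfun C D)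
    : Prop :=
  exists (G : rfun D C)
    (eta : forall X : C, hom X (G (F X)))
    (eps : forall Y : D, hom (F (G Y)) Y),
    [/\ forall X, is_iso (eta X),
        forall X X' (f : hom X X'),
          eta X' \oc f = fmor G (fmor F f) \oc eta X,
        forall Y, is_iso (eps Y)
      & forall Y Y' (g : hom Y Y'),
          g \oc eps Y = eps Y' \oc fmor F (fmor G g)].

Record pretricat (R : comPzRingType) := PreTriCat {
  pt_cat :> rcat R;
  shift : rfun pt_cat pt_cat;
  dist : forall X Y Z : pt_cat,
    hom X Y -> hom Y Z -> hom Z (shift X) -> Prop
}.

Arguments shift {R} p.
Arguments dist {R p X Y Z} f g h.

Record is_triangulated (R : comPzRingType) (T : pretricat R) : Prop :=
  IsTriangulated {
  zero_ex : exists Z : T, is_zero Z;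
  biproduct_ex : forall U V : T, exists B : T, is_biproduct B U V;
  shift_equiv : is_equivalence (shift T);
  tr1_id : forall X Z : T, is_zero Z ->
    dist (idm X) (0 : hom X Z) (0 : hom Z (shift T X));
  tr1_iso : forall (X Y Z X' Y' Z' : T)
      (f : hom X Y) (g : hom Y Z) (h : hom Z (shift T X))
      (f' : hom X' Y') (g' : hom Y' Z') (h' : hom Z' (shift T X'))
      (a : hom X X') (b : hom Y Y') (c : hom Z Z'),
    is_iso a -> is_iso b -> is_iso c ->
    b \oc f = f' \oc a -> c \oc g = g' \oc b ->
    fmor (shift T) a \oc h = h' \oc c ->
    dist f g h -> dist f' g' h';
  tr1_cone : forall (X Y : T) (f : hom X Y),
    exists (Z : T) (g : hom Y Z) (h : hom Z (shift T X)), dist f g h;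
  tr2 : forall (X Y Z : T)
      (f : hom X Y) (g : hom Y Z) (h : hom Z (shift T X)),
    dist f g h <-> dist g h (- fmor (shift T) f);
  tr3 : forall (X Y Z X' Y' Z' : T)
      (f : hom X Y) (g : hom Y Z) (h : hom Z (shift T X))
      (f' : hom X' Y') (g' : hom Y' Z') (h' : hom Z' (shift T X'))
      (a : hom X X') (b : hom Y Y'),
    dist f g h -> dist f' g' h' -> b \oc f = f' \oc a ->
    exists c : hom Z Z',
      c \oc g = g' \oc b /\ fmor (shift T) a \oc h = h' \oc c;
  tr4 : forall (X Y Z Z' X' Y' : T)
      (f : hom X Y) (a : hom Y Z') (b : hom Z' (shift T X))
      (g : hom Y Z) (c : hom Z X') (d : hom X' (shift T Y))
      (e : hom Z Y') (k : hom Y' (shift T X)),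
    dist f a b -> dist g c d -> dist (g \oc f) e k ->
    exists (u : hom Z' Y') (v : hom Y' X'),
      dist u v (fmor (shift T) a \oc d) /\
      [/\ u \oc a = e \oc g, k \oc u = b, v \oc e = c
        & d \oc v = fmor (shift T) f \oc k]
}.

(* The shift is only required to be an autoequivalence, which includes the
   convention where it is an automorphism. *)
Record tricat (R : comPzRingType) := TriCat {
  tc_pre :> pretricat R;
  tc_triangulated : is_triangulated tc_pre
}.

Record trifun (R : comPzRingType) (C D : tricat R) := TriFun {
  tf_fun :> rfun C D;
  tf_shift : forall X : C, hom (tf_fun (shift C X)) (shift D (tf_fun X));
  tf_shift_iso : forall X, is_iso (tf_shift X);
  tf_shift_nat : forall (X Y : C) (f : hom X Y),
    tf_shift Y \oc fmor tf_fun (fmor (shift C) f)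
    = fmor (shift D) (fmor tf_fun f) \oc tf_shift X;
  tf_dist : forall (X Y Z : C)
      (f : hom X Y) (g : hom Y Z) (h : hom Z (shift C X)),
    dist f g h ->
    dist (fmor tf_fun f) (fmor tf_fun g) (tf_shift X \oc fmor tf_fun h)
}.

(* Full subcategories closed under isomorphism are given by predicates on
   objects. *)
Record triangulated_subcat (R : comPzRingType) (C : tricat R) (P : C -> Prop)
    : Prop := TriangulatedSubcat {
  ts_zero : forall X : C, is_zero X -> P X;
  ts_iso : forall X Y : C, isomorphic X Y -> P X -> P Y;
  ts_shift : forall X : C, P X <-> P (shift C X);
  ts_cone : forall (X Y Z : C)
      (f : hom X Y) (g : hom Y Z) (h : hom Z (shift C X)),
    dist f g h -> P X -> P Y -> P Z
}.

(* C = P (+) Q *)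
Definition decomposes (R : comPzRingType) (C : tricat R) (P Q : C -> Prop)
    : Prop :=
  (forall X : C, exists U V B : C,
     [/\ P U, Q V, is_biproduct B U V & isomorphic X B]) /\
  (forall U V : C, P U -> Q V ->
     (forall f : hom U V, f = 0) /\ (forall f : hom V U, f = 0)).

Definition connected (R : comPzRingType) (C : tricat R) : Prop :=
  ~ (forall X : C, is_zero X) /\
  (forall P Q : C -> Prop,
     triangulated_subcat P -> triangulated_subcat Q -> decomposes P Q ->
     (forall X, P X -> is_zero X) \/ (forall X, Q X -> is_zero X)).

Section ZeroObjects.
Context {R : comPzRingType} {C : rcat R}.

Lemma comp0m (X Y Z : C) (f : hom X Y) : (0 : hom Y Z) \oc f = 0.
Proof.
have := comp_linearl f (1 : R) (0 : hom Y Z) 0.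
rewrite !scale1r addr0 => h; apply: (addIr ((0 : hom Y Z) \oc f)).
by rewrite add0r -h.
Qed.

Lemma compm0 (X Y Z : C) (g : hom Y Z) : g \oc (0 : hom X Y) = 0.
Proof.
have := comp_linearr g (1 : R) (0 : hom X Y) 0.
rewrite !scale1r addr0 => h; apply: (addIr (g \oc (0 : hom X Y))).
by rewrite add0r -h.
Qed.

Lemma is_zeroP (X : C) : is_zero X <-> idm X = 0.
Proof.
split=> [zX|e Y]; first by case: (zX X).
split=> f; first by rewrite -(compm1 f) e compm0.
by rewrite -(comp1m f) e comp0m.
Qed.

Lemma zero_is_iso (X Y : C) (f : hom X Y) : is_zero X -> is_zero Y -> is_iso f.
Proof.
move=> /is_zeroP eX /is_zeroP eY.
by exists 0; rewrite eX eY comp0m compm0.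
Qed.

Lemma is_zero_biproduct (B U V : C) :
  is_zero U -> is_zero V -> is_biproduct B U V -> is_zero B.
Proof.
move=> zU zV [i1 [i2 [p1 [p2 [_ _ _ _ e]]]]]; apply/is_zeroP.
by rewrite -e ((zU _).1 i1) ((zV _).1 i2) !comp0m addr0.
Qed.

End ZeroObjects.

Lemma is_zero_fob (R : comPzRingType) (C D : rcat R) (F : rfun C D) (X : C) :
  is_zero X -> is_zero (F X).
Proof. by move=> /is_zeroP e; apply/is_zeroP; rewrite -fmor1 e raddf0. Qed.

(* The R-module of all families, which has no dependent instance in the
   library. *)
Definition dprod (R : comPzRingType) (I : Type) (M : I -> lmodType R) : Type :=
  forall i, M i.

Section DProd.
Variables (R : comPzRingType) (I : Type) (M : I -> lmodType R).
Implicit Types f g h : dprod M.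

HB.instance Definition _ := gen_eqMixin (dprod M).
HB.instance Definition _ := gen_choiceMixin (dprod M).

Definition dprod_zero : dprod M := fun=> 0.
Definition dprod_opp f : dprod M := fun i => - f i.
Definition dprod_add f g : dprod M := fun i => f i + g i.
Definition dprod_scale (a : R) f : dprod M := fun i => a *: f i.

Let dext f g : (forall i, f i = g i) -> f = g.
Proof. exact: functional_extensionality_dep. Qed.

Fact dprod_addA : associative dprod_add.
Proof. by move=> f g h; apply: dext => i; exact: addrA. Qed.
Fact dprod_addC : commutative dprod_add.
Proof. by move=> f g; apply: dext => i; exact: addrC. Qed.
Fact dprod_add0 : left_id dprod_zero dprod_add.
Proof. by move=> f; apply: dext => i; exact: add0r. Qed.
Fact dprod_addN : left_inverse dprod_zero dprod_opp dprod_add.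
Proof. by move=> f; apply: dext => i; exact: addNr. Qed.

HB.instance Definition _ :=
  GRing.isZmodule.Build (dprod M) dprod_addA dprod_addC dprod_add0 dprod_addN.

Fact dprod_scaleA a b f :
  dprod_scale a (dprod_scale b f) = dprod_scale (a * b) f.
Proof. by apply: dext => i; exact: scalerA. Qed.
Fact dprod_scale1 : left_id 1 dprod_scale.
Proof. by move=> f; apply: dext => i; exact: scale1r. Qed.
Fact dprod_scaleDr : right_distributive dprod_scale +%R.
Proof. by move=> a f g; apply: dext => i; exact: scalerDr. Qed.
Fact dprod_scaleDl f : {morph dprod_scale^~ f : a b / a + b}.
Proof. by move=> a b; apply: dext => i; exact: scalerDl. Qed.

HB.instance Definition _ := GRing.Zmodule_isLmodule.Build R (dprod M)
  dprod_scaleA dprod_scale1 dprod_scaleDr dprod_scaleDl.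

End DProd.

Section DSumCat.
Variables (R : comPzRingType) (I : Type) (C : I -> rcat R).

Definition nonzero_at (U : forall i, C i) : set I :=
  [set i | ~ is_zero (U i)]%classic.

Record dsum_ob := DSumOb {
  ds_fam :> forall i, C i;
  ds_fin : finite_set (nonzero_at ds_fam)
}.

(* Only finitely many factors are non-zero, so this product of modules is also
   their direct sum. *)
Definition dsum_hom (U V : dsum_ob) : lmodType R :=
  dprod (fun i => hom (U i) (V i)).

Definition dsum_id (U : dsum_ob) : dsum_hom U U := fun i => idm (U i).
Definition dsum_comp (U V W : dsum_ob) (g : dsum_hom V W) (f : dsum_hom U V)
  : dsum_hom U W := fun i => g i \oc f i.

Let dext (U V : dsum_ob) (f g : dsum_hom U V) : (forall i, f i = g i) -> f = g.
Proof. exact: functional_extensionality_dep. Qed.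

Fact dsum_comp1m U V (f : dsum_hom U V) : dsum_comp (dsum_id V) f = f.
Proof. by apply: dext => i; exact: comp1m. Qed.
Fact dsum_compm1 U V (f : dsum_hom U V) : dsum_comp f (dsum_id U) = f.
Proof. by apply: dext => i; exact: compm1. Qed.
Fact dsum_compA U V W T (h : dsum_hom W T) (g : dsum_hom V W)
  (f : dsum_hom U V) : dsum_comp h (dsum_comp g f) = dsum_comp (dsum_comp h g) f.
Proof. by apply: dext => i; exact: compA. Qed.
Fact dsum_comp_linearr U V W (g : dsum_hom V W) :
  linear (fun f : dsum_hom U V => dsum_comp g f).
Proof. by move=> a f f'; apply: dext => i; exact: comp_linearr. Qed.
Fact dsum_comp_linearl U V W (f : dsum_hom U V) :
  linear (fun g : dsum_hom V W => dsum_comp g f).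
Proof. by move=> a g g'; apply: dext => i; exact: (comp_linearl (f i)). Qed.

Definition dsum_cat : rcat R :=
  RCat dsum_comp1m dsum_compm1 dsum_compA dsum_comp_linearr dsum_comp_linearl.

End DSumCat.

Section DSumFun.
Variables (R : comPzRingType) (I : Type) (C D : I -> rcat R).
Variable F : forall i, rfun (C i) (D i).

Fact dsum_fob_fin (U : dsum_cat C) : finite_set (nonzero_at (fun i => F i (U i))).
Proof.
by apply: sub_finite_set (ds_fin U) => i /= nz zU; apply: nz; exact: is_zero_fob.
Qed.

Definition dsum_fob (U : dsum_cat C) : dsum_cat D := DSumOb (dsum_fob_fin U).

Definition dsum_fmor (U V : dsum_cat C) (f : hom U V)
  : hom (dsum_fob U) (dsum_fob V) := fun i => fmor (F i) (f i).

Fact dsum_fmor_linear U V : linear (@dsum_fmor U V).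
Proof.
move=> a f g; apply: functional_extensionality_dep => i; exact: linearP.
Qed.

HB.instance Definition _ U V := GRing.isLinear.Build R _ _ _ (@dsum_fmor U V)
  (@dsum_fmor_linear U V).

Fact dsum_fmor1 (U : dsum_cat C) : dsum_fmor (idm U) = idm (dsum_fob U).
Proof. by apply: functional_extensionality_dep => i; exact: fmor1. Qed.
Fact dsum_fmorM (U V W : dsum_cat C) (g : hom V W) (f : hom U V) :
  dsum_fmor (g \oc f) = dsum_fmor g \oc dsum_fmor f.
Proof. by apply: functional_extensionality_dep => i; exact: fmorM. Qed.

Definition dsum_fun : rfun (dsum_cat C) (dsum_cat D) :=
  @RFun R (dsum_cat C) (dsum_cat D) dsum_fob
    (fun U V => @dsum_fmor U V : {linear _ -> _}) dsum_fmor1 dsum_fmorM.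

End DSumFun.

Section DSum.
Variables (R : comPzRingType) (I : Type) (C : I -> tricat R).

Definition dsum_pre : pretricat R :=
  @PreTriCat R (dsum_cat C) (dsum_fun (fun i => shift (C i)))
    (fun X Y Z f g h => forall i, dist (f i) (g i) (h i)).

Let dext (U V : dsum_pre) (f g : hom U V) : (forall i, f i = g i) -> f = g.
Proof. exact: functional_extensionality_dep. Qed.

Let dchoice (T : I -> Type) (P : forall i, T i -> Prop) :
  (forall i, exists x, P i x) -> exists f : forall i, T i, forall i, P i (f i).
Proof.
by move=> h; exists (fun i => projT1 (cid (h i))) => i; exact: (projT2 (cid (h i))).
Qed.

Lemma dsum_isoP (U V : dsum_pre) (f : hom U V) :
  is_iso f <-> forall i, is_iso (f i).
Proof.
split=> [[g [gf fg]] i|/dchoice[g hg]].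
  exists (g i); split.
    exact: (congr1 (fun k : hom U U => k i) gf).
  exact: (congr1 (fun k : hom V V => k i) fg).
by exists g; split; apply: dext => i; case: (hg i).
Qed.

Lemma dsum_zeroP (U : dsum_pre) : is_zero U <-> forall i, is_zero (U i).
Proof.
split=> [/is_zeroP e i|h].
  by apply/is_zeroP; exact: (congr1 (fun k : hom U U => k i) e).
by apply/is_zeroP; apply: dext => i; exact/is_zeroP.
Qed.

Fact dsum_triangulated : is_triangulated dsum_pre.
Proof.
split.
- have [Z hZ] := dchoice (fun i => zero_ex (tc_triangulated (C i))).
  have fZ : finite_set (nonzero_at Z).
    by apply: sub_finite_set (finite_set0 I) => i /= nz; apply: nz.
  by exists (DSumOb fZ); apply/dsum_zeroP.
- move=> U V.
  have [B hB] := dchoice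
    (fun i => biproduct_ex (tc_triangulated (C i)) (U i) (V i)).
  have fB : finite_set (nonzero_at B).
    apply: (@sub_finite_set _ _ (nonzero_at U `|` nonzero_at V)%classic).
      move=> i nz; apply: contrapT => /not_orP[/contrapT zU /contrapT zV].
      by apply: nz; apply: is_zero_biproduct (hB i).
    by rewrite finite_setU; split; exact: ds_fin.
  exists (DSumOb fB).
  have [i1 /dchoice[i2 /dchoice[p1 /dchoice[p2 h]]]] := dchoice hB.
  exists i1, i2, p1, p2.
  by split; apply: dext => i; case: (h i).
- have [G /dchoice[eta /dchoice[eps h]]] :=
    dchoice (fun i => shift_equiv (tc_triangulated (C i))).
  exists (dsum_fun G), (fun (X : dsum_pre) i => eta i (X i)),
    (fun (Y : dsum_pre) i => eps i (Y i)).
  split=> [X|X X' f|Y|Y Y' g].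
  + by apply/dsum_isoP => i; case: (h i) => n _ _ _; exact: n.
  + by apply: dext => i; case: (h i) => _ n _ _; exact: n.
  + by apply/dsum_isoP => i; case: (h i) => _ _ n _; exact: n.
  + by apply: dext => i; case: (h i) => _ _ _ n; exact: n.
- move=> X Z /dsum_zeroP zZ i; exact: (tr1_id (tc_triangulated (C i))).
- move=> X Y Z X' Y' Z' f g h f' g' h' a b c.
  move=> /dsum_isoP ia /dsum_isoP ib /dsum_isoP ic e1 e2 e3 d i.
  apply: (tr1_iso (tc_triangulated (C i)) (ia i) (ib i) (ic i) _ _ _ (d i)).
  + exact: (congr1 (fun k : hom X Y' => k i) e1).
  + exact: (congr1 (fun k : hom Y Z' => k i) e2).
  + exact: (congr1 (fun k : hom Z (shift dsum_pre X') => k i) e3).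
- move=> X Y f.
  have H i : exists Z : C i, (is_zero (X i) -> is_zero (Y i) -> is_zero Z) /\
      exists (g : hom (Y i) Z) (h : hom Z (shift (C i) (X i))), dist (f i) g h.
    have tC := tc_triangulated (C i).
    have [[zX zY]|nz] := pselect (is_zero (X i) /\ is_zero (Y i)).
      have [Z zZ] := zero_ex tC; exists Z; split=> //; exists 0, 0.
      apply: (tr1_iso tC (a := idm (X i)) (b := f i) (c := idm Z) _ _ _ _ _ _
               (tr1_id tC (X i) zZ)); try exact: zero_is_iso.
      + by rewrite !compm1.
      + by rewrite compm0 comp0m.
      + by rewrite compm0 comp0m.
    have [Z [g [h d]]] := tr1_cone tC (f i).
    by exists Z; split=> [zX zY|]; [case: nz | exists g, h].
  have [Z hZ] := dchoice H.
  have fZ : finite_set (nonzero_at Z).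
    apply: (@sub_finite_set _ _ (nonzero_at X `|` nonzero_at Y)%classic).
      move=> i nz; apply: contrapT => /not_orP[/contrapT zX /contrapT zY].
      by apply: nz; exact: (hZ i).1.
    by rewrite finite_setU; split; exact: ds_fin.
  have [g /dchoice[h d]] := dchoice (fun i => (hZ i).2).
  by exists (DSumOb fZ), g, h.
- move=> X Y Z f g h; split=> d i.
    exact: (tr2 (tc_triangulated (C i)) (f i) (g i) (h i)).1 (d i).
  exact: (tr2 (tc_triangulated (C i)) (f i) (g i) (h i)).2 (d i).
- move=> X Y Z X' Y' Z' f g h f' g' h' a b d d' e.
  have [c hc] := dchoice (fun i => tr3 (tc_triangulated (C i)) (d i) (d' i)
    (congr1 (fun k : hom X Y' => k i) e)).
  by exists c; split; apply: dext => i; case: (hc i).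
- move=> X Y Z Z' X' Y' f a b g c d e k d1 d2 d3.
  have [u /dchoice[v h]] := dchoice
    (fun i => tr4 (tc_triangulated (C i)) (d1 i) (d2 i) (d3 i)).
  exists u, v; split; first by move=> i; case: (h i).
  by split; apply: dext => i; case: (h i) => _ [].
Qed.

Definition dsum : tricat R := TriCat dsum_triangulated.

End DSum.

(* Main.v *)
(** Connectedness forces [Phi] to send each [C i] into a single summand [D j]:
   for fixed [j], the objects of [C i] whose image is concentrated in [j] and
   those whose image vanishes in [j] form a decomposition of [C i].  The same
   argument applies to a quasi-inverse [G], and the two resulting maps of
   indices are inverse to each other.  The functor [G] is not known to be exact,
   but the objects of [D j] whose image vanishes in [C i] are those right
   orthogonal to [Phi (C i)], hence form a triangulated subcategory.
   The [pi i]-component of [Phi] on [C i] is then fully faithful and essentially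
   surjective. *)
From HB Require Import structures.
From mathcomp Require Import all_boot all_algebra.
From mathcomp Require Import boolp classical_sets functions cardinality.
Require Import Defs.

Set Implicit Arguments.
Unset Strict Implicit.
Unset Printing Implicit Defensive.

Import GRing.Theory.
Local Open Scope ring_scope.

(** * Retracts, isomorphisms and biproducts in [R]-linear categories *)

Section Retracts.
Context {R : comPzRingType}.

(** Retracts are preserved by every functor and a retract of a zero object is zero, so this relation
    suffices to transport vanishing. *)
Definition is_retract (C : rcat R) (X Y : C) : Prop :=
  exists (s : hom X Y) (r : hom Y X), r \oc s = idm X.

Lemma is_retract_trans (C : rcat R) (X Y Z : C) :
  is_retract X Y -> is_retract Y Z -> is_retract X Z.
Proof.
move=> [s [r e]] [s' [r' e']]; exists (s' \oc s), (r \oc r').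
by rewrite compA -(compA r) e' compm1.
Qed.

Lemma is_zero_retract (C : rcat R) (X Y : C) :
  is_retract X Y -> is_zero Y -> is_zero X.
Proof. by move=> [s [r e]] zY; apply/is_zeroP; rewrite -e ((zY X).2 s) compm0. Qed.

Lemma isomorphic_retract (C : rcat R) (X Y : C) :
  isomorphic X Y -> is_retract X Y.
Proof. by move=> [f [g [e _]]]; exists f, g. Qed.

Lemma isomorphic_sym (C : rcat R) (X Y : C) :
  isomorphic X Y -> isomorphic Y X.
Proof. by move=> [f [g [e e']]]; exists g, f. Qed.

Lemma isomorphic_trans (C : rcat R) (X Y Z : C) :
  isomorphic X Y -> isomorphic Y Z -> isomorphic X Z.
Proof.
move=> [f [g [e e']]] [h [k [u u']]].
exists (h \oc f), (g \oc k).
by rewrite !compA -(compA g) u compm1 e -(compA h) e' compm1.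
Qed.

Lemma is_iso_fmor (C D : rcat R) (F : rfun C D) (X Y : C) (f : hom X Y) :
  is_iso f -> is_iso (fmor F f).
Proof. by move=> [g [e e']]; exists (fmor F g); rewrite -!fmorM e e' !fmor1. Qed.

Lemma isomorphic_fob (C D : rcat R) (F : rfun C D) (X Y : C) :
  isomorphic X Y -> isomorphic (F X) (F Y).
Proof. by move=> [f hf]; exists (fmor F f); exact: is_iso_fmor. Qed.

Lemma is_retract_fob (C D : rcat R) (F : rfun C D) (X Y : C) :
  is_retract X Y -> is_retract (F X) (F Y).
Proof. by move=> [s [r e]]; exists (fmor F s), (fmor F r); rewrite -fmorM e fmor1. Qed.

Lemma is_iso_comp (C : rcat R) (X Y Z : C) (g : hom Y Z) (f : hom X Y) :
  is_iso g -> is_iso f -> is_iso (g \oc f).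
Proof.
move=> [h [k u]] [f' [e e']]; exists (f' \oc h).
by rewrite !compA -(compA f') k compm1 e -(compA g) e' compm1.
Qed.

Lemma iso_precomp_eq0 (C : rcat R) (X Y Z : C) (g : hom Y Z) (f : hom X Y) :
  is_iso f -> g \oc f = 0 -> g = 0.
Proof. by move=> [f' [_ e]] h; rewrite -(compm1 g) -e compA h comp0m. Qed.

Lemma iso_postcomp_eq0 (C : rcat R) (X Y Z : C) (g : hom Y Z) (f : hom X Y) :
  is_iso g -> g \oc f = 0 -> f = 0.
Proof. by move=> [g' [e _]] h; rewrite -(comp1m f) -e -compA h compm0. Qed.

Lemma iso_precomp_inj (C : rcat R) (X Y Z : C) (g g' : hom Y Z) (f : hom X Y) :
  is_iso f -> g \oc f = g' \oc f -> g = g'.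
Proof. by move=> [f' [_ e]] h; rewrite -(compm1 g) -e compA h -compA e compm1. Qed.

Lemma iso_postcomp_inj (C : rcat R) (X Y Z : C) (g : hom Y Z) (f f' : hom X Y) :
  is_iso g -> g \oc f = g \oc f' -> f = f'.
Proof. by move=> [g' [e _]] h; rewrite -(comp1m f) -e -compA h compA e comp1m. Qed.

Lemma comp_oppr (C : rcat R) (X Y Z : C) (g : hom Y Z) (f : hom X Y) :
  g \oc (- f) = - (g \oc f).
Proof.
have := comp_linearr g (-1) f (0 : hom X Y).
by rewrite compm0 !addr0 !scaleN1r.
Qed.

Lemma comp_oppl (C : rcat R) (X Y Z : C) (g : hom Y Z) (f : hom X Y) :
  (- g) \oc f = - (g \oc f).
Proof.
have := comp_linearl f (-1) g (0 : hom Y Z).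
by rewrite comp0m !addr0 !scaleN1r.
Qed.

Lemma is_biproduct_fob (C D : rcat R) (F : rfun C D) (B U V : C) :
  is_biproduct B U V -> is_biproduct (F B) (F U) (F V).
Proof.
move=> [i1 [i2 [p1 [p2 [e1 e2 e3 e4 e5]]]]].
exists (fmor F i1), (fmor F i2), (fmor F p1), (fmor F p2).
by split; rewrite -!fmorM ?(e1, e2, e3, e4) ?(fmor1, raddf0) // -raddfD /= e5 fmor1.
Qed.

Lemma biproduct_zerol (C : rcat R) (B U V : C) :
  is_zero U -> is_biproduct B U V -> is_retract B V.
Proof.
move=> zU [i1 [i2 [p1 [p2 [_ _ _ _ e]]]]]; exists p2, i2.
by rewrite -e ((zU _).1 i1) comp0m add0r.
Qed.

Lemma biproduct_zeror (C : rcat R) (B U V : C) :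
  is_zero V -> is_biproduct B U V -> is_retract B U.
Proof.
move=> zU [i1 [i2 [p1 [p2 [_ _ _ _ e]]]]]; exists p1, i1.
by rewrite -e ((zU _).1 i2) comp0m addr0.
Qed.

Lemma biproduct_retractl (C : rcat R) (B U V : C) :
  is_biproduct B U V -> is_retract U B.
Proof. by move=> [i1 [i2 [p1 [p2 []]]]]; exists i1, p1. Qed.

Lemma biproduct_retractr (C : rcat R) (B U V : C) :
  is_biproduct B U V -> is_retract V B.
Proof. by move=> [i1 [i2 [p1 [p2 []]]]]; exists i2, p2. Qed.

End Retracts.

Lemma dep_choice (I : Type) (T : I -> Type) (P : forall i, T i -> Prop) :
  (forall i, exists x, P i x) -> exists f : forall i, T i, forall i, P i (f i).
Proof.
by move=> h; exists (fun i => projT1 (cid (h i))) => i; exact: (projT2 (cid (h i))).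
Qed.

(** * Equivalences as fully faithful, essentially surjective functors *)

Section Equivalences.
Context {R : comPzRingType}.

Definition faithful (C D : rcat R) (F : rfun C D) : Prop :=
  forall (X Y : C) (f : hom X Y), fmor F f = 0 -> f = 0.

Definition full (C D : rcat R) (F : rfun C D) : Prop :=
  forall (X Y : C) (g : hom (F X) (F Y)), exists f : hom X Y, fmor F f = g.

(** Full faithfulness with objectwise isomorphisms stands in for a natural unit and counit; the
    symmetry in [F] and [G] lets the support arguments run in both directions. *)
Definition quasi_inverse (C D : rcat R) (F : rfun C D) (G : rfun D C) : Prop :=
  [/\ faithful F, full F & forall Y, isomorphic (F (G Y)) Y]
  /\ [/\ faithful G, full G & forall X, isomorphic (G (F X)) X].

Lemma faithful_inj (C D : rcat R) (F : rfun C D) (X Y : C) (f g : hom X Y) :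
  faithful F -> fmor F f = fmor F g -> f = g.
Proof.
move=> fF e; apply/eqP; rewrite -subr_eq0; apply/eqP; apply: fF.
by rewrite raddfB /= e subrr.
Qed.

Lemma faithful_is_zero (C D : rcat R) (F : rfun C D) (X : C) :
  faithful F -> is_zero (F X) -> is_zero X.
Proof. by move=> fF /is_zeroP e; apply/is_zeroP/fF; rewrite fmor1. Qed.

(** Naturality of [eta] makes [F] faithful and naturality of [eps] makes [G] faithful; fullness of
    each then follows from faithfulness of the other. *)
Lemma equivalence_quasi_inverse (C D : rcat R) (F : rfun C D) :
  is_equivalence F -> exists G : rfun D C, quasi_inverse F G.
Proof.
move=> [G [eta [eps [ieta neta ieps neps]]]]; exists G.
have fF : faithful F.
  move=> X Y f e; apply: (iso_postcomp_eq0 (ieta Y)).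
  by rewrite neta e raddf0 comp0m.
have fG : faithful G.
  move=> X Y g e; apply: (iso_precomp_eq0 (ieps X)).
  by rewrite neps e raddf0 compm0.
split; split=> //; [move=> X Y g|move=> Y|move=> X Y g|move=> X].
- have [e' [_ he]] := ieta Y.
  exists (e' \oc (fmor G g \oc eta X)).
  apply: (faithful_inj fG); apply: (iso_precomp_inj (ieta X)).
  by rewrite -neta compA he comp1m.
- by exists (eps Y).
- have [e' [he _]] := ieps X.
  exists (eps Y \oc (fmor F g \oc e')).
  apply: (faithful_inj fF); apply: (iso_postcomp_inj (ieps Y)).
  by rewrite -neps -!compA he compm1.
- by apply: isomorphic_sym; exists (eta X).
Qed.

Lemma quasi_inverse_sym (C D : rcat R) (F : rfun C D) (G : rfun D C) :
  quasi_inverse F G -> quasi_inverse G F.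
Proof. by case. Qed.

Definition linear_of (U V : lmodType R) (f : U -> V) (hf : linear f)
  : {linear U -> V} := HB.pack f (GRing.isLinear.Build R U V *:%R f hf).

Lemma fully_faithful_is_iso (C D : rcat R) (F : rfun C D) (X Y : C)
    (f : hom X Y) :
  faithful F -> full F -> is_iso (fmor F f) -> is_iso f.
Proof.
move=> fF uF [g' [e e']]; have [g hg] := uF _ _ g'; exists g.
by split; apply: (faithful_inj fF); rewrite fmorM hg fmor1.
Qed.

Lemma fully_faithful_equivalence (C D : rcat R) (F : rfun C D) :
  faithful F -> full F -> (forall Y, exists X, isomorphic (F X) Y) ->
  is_equivalence F.
Proof.
move=> fF uF /dep_choice[G0 /dep_choice[e ie]].
have [e' he] := dep_choice ie.
(* On morphisms, [G] is the preimage under [F] of conjugation by the chosen isomorphisms; linearity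
   and functoriality are checked after applying the faithful [F]. *)
pose Gm Y Y' (g : hom Y Y') := projT1 (cid (uF _ _ (e' Y' \oc (g \oc e Y)))).
have FGm Y Y' (g : hom Y Y') : fmor F (Gm Y Y' g) = e' Y' \oc (g \oc e Y).
  exact: (projT2 (cid (uF _ _ (e' Y' \oc (g \oc e Y))))).
have Gm_linear Y Y' : linear (Gm Y Y').
  move=> a g g'; apply: (faithful_inj fF).
  by rewrite linearP /= !FGm (comp_linearl (e Y)) comp_linearr.
have Gm1 Y : Gm Y Y (idm Y) = idm (G0 Y).
  by apply: (faithful_inj fF); rewrite FGm comp1m fmor1; case: (he Y).
have GmM Y Y' Y'' (g : hom Y' Y'') (f : hom Y Y') :
    Gm Y Y'' (g \oc f) = Gm Y' Y'' g \oc Gm Y Y' f.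
  apply: (faithful_inj fF); rewrite fmorM !FGm -!compA.
  by rewrite (compA (e Y')) (he Y').2 comp1m.
pose G := @RFun R D C G0 (fun Y Y' => linear_of (Gm_linear Y Y')) Gm1 GmM.
(* The unit at [X] is the preimage of the inverse of the counit at [F X]. *)
have [eta Feta] := dep_choice (fun X => uF X (G0 (F X)) (e' (F X))).
exists G, eta, e; split=> [X|X X' f|Y|Y Y' g].
- apply: (fully_faithful_is_iso fF uF); rewrite Feta.
  by exists (e (F X)); case: (he (F X)).
- apply: (faithful_inj fF); rewrite !fmorM !Feta /= FGm -!compA.
  by rewrite (he (F X)).2 compm1.
- exact: ie.
- by rewrite /= FGm compA (he Y').2 comp1m.
Qed.

End Equivalences.

(** * Triangulated subcategories and exact functors *)

Section Triangulated.
Context {R : comPzRingType}.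

(** Such a sequence is isomorphic to the identity triangle on [X]; this makes the zero functor
    exact. *)
Lemma dist_zero (T : tricat R) (X Y Z : T)
    (f : hom X Y) (g : hom Y Z) (h : hom Z (shift T X)) :
  is_zero X -> is_zero Y -> is_zero Z -> dist f g h.
Proof.
move=> zX zY zZ; have tT := tc_triangulated T.
apply: (tr1_iso tT (a := idm X) (b := f) (c := idm Z) _ _ _ _ _ _
  (tr1_id tT X zZ)); try exact: zero_is_iso.
- by rewrite !compm1.
- by rewrite compm0 ((zY Z).1 g) comp0m.
- by rewrite compm0 ((zZ _).1 h) comp0m.
Qed.

(** The lifting half of the exactness of [hom W] at [Z], obtained by completing [v] to a morphism of
    rotated triangles. *)
Lemma dist_lift (T : tricat R) (X Y Z W : T)
    (f : hom X Y) (g : hom Y Z) (h : hom Z (shift T X)) (v : hom W Z) :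
  dist f g h -> h \oc v = 0 -> exists w : hom W Y, v = g \oc w.
Proof.
move=> d e; have tT := tc_triangulated T.
have [S [[fS uS _] _]] := equivalence_quasi_inverse (shift_equiv tT).
have [Z0 zZ0] := zero_ex tT.
have d0 := (tr2 tT _ _ _).1 (tr1_id tT W zZ0).
have d1 := (tr2 tT _ _ _).1 d.
(* Map W -> 0 -> W[1] to Z -> X[1] -> Y[1]; the third map is a shift. *)
have [|c [_ hc]] := tr3 tT d0 ((tr2 tT _ _ _).1 d1) (a := v) (b := 0).
  by rewrite comp0m e.
have [w hw] := uS _ _ c; exists w; apply: (faithful_inj fS).
move: hc; rewrite -hw comp_oppl comp_oppr !fmor1 compm1 => /oppr_inj ->.
by rewrite fmorM.
Qed.

(** The identity of [Z] lifts along [g], hence factors through the zero object [Y]. *)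
Lemma cone_is_zero (T : tricat R) (X Y Z : T)
    (f : hom X Y) (g : hom Y Z) (h : hom Z (shift T X)) :
  dist f g h -> is_zero X -> is_zero Y -> is_zero Z.
Proof.
move=> d zX zY; have zSX := is_zero_fob (shift T) zX.
have [|w e] := dist_lift (v := idm Z) d; first by rewrite ((zSX _).2 h) comp0m.
by apply/is_zeroP; rewrite e ((zY _).1 g) comp0m.
Qed.

Lemma shift_faithful (T : tricat R) : faithful (shift T).
Proof.
by have [G [[]]] := equivalence_quasi_inverse (shift_equiv (tc_triangulated T)).
Qed.

Lemma shift_full (T : tricat R) : full (shift T).
Proof.
by have [G [[]]] := equivalence_quasi_inverse (shift_equiv (tc_triangulated T)).
Qed.

Lemma shift_ess_surj (T : tricat R) (X : T) :
  exists Y : T, isomorphic (shift T Y) X.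
Proof.
have [G [[_ _ h] _]] := equivalence_quasi_inverse (shift_equiv (tc_triangulated T)).
by exists (G X).
Qed.

Lemma triangulated_subcat_zero (T : tricat R) :
  triangulated_subcat (fun X : T => is_zero X).
Proof.
split=> // [X Y XY zX|X|X Y Z f g h]; last exact: cone_is_zero.
  exact: is_zero_retract (isomorphic_retract (isomorphic_sym XY)) zX.
split; first exact: is_zero_fob.
exact: faithful_is_zero (@shift_faithful T).
Qed.

Lemma triangulated_subcat_preim (C D : tricat R) (F : trifun C D)
    (P : D -> Prop) :
  triangulated_subcat P -> triangulated_subcat (fun X => P (F X)).
Proof.
move=> [Pz Pi Ps Pc]; split=> [X zX|X Y XY|X|X Y Z f g h d].
- exact/Pz/is_zero_fob.
- exact/Pi/isomorphic_fob.
- have iX : isomorphic (F (shift C X)) (shift D (F X)).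
    by exists (tf_shift F X); exact: tf_shift_iso.
  split=> [/Ps|h]; first exact/Pi/isomorphic_sym.
  exact/Ps/(Pi _ _ iX).
- exact: Pc (tf_dist F d).
Qed.

(** With [A] the indices other than a fixed one, this handles the objects whose image is
    concentrated in a single summand. *)
Lemma triangulated_subcat_bigcap (C : tricat R) (J : Type) (A : J -> Prop)
    (P : J -> C -> Prop) :
  (forall j, triangulated_subcat (P j)) ->
  triangulated_subcat (fun X => forall j, A j -> P j X).
Proof.
move=> h; split=> [X zX j _|X Y XY PX j Aj|X|X Y Z f g k d PX PY j Aj].
- exact: (ts_zero (h j)).
- by apply: (ts_iso (h j) XY); exact: PX.
- split=> PX j Aj; first exact: (ts_shift (h j) X).1 (PX j Aj).
  exact: (ts_shift (h j) X).2 (PX j Aj).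
- by apply: (ts_cone (h j) d); [exact: PX|exact: PY].
Qed.

(** A morphism from [F W] to a cone becomes zero in [shift D X], which is again right orthogonal, so
    it lifts to [Y] and vanishes there. *)
Lemma triangulated_subcat_orth (C D : tricat R) (F : trifun C D) :
  triangulated_subcat (fun Y : D => forall W (f : hom (F W) Y), f = 0).
Proof.
have SS Y : (forall W (f : hom (F W) Y), f = 0) ->
    forall W (f : hom (F W) (shift D Y)), f = 0.
  move=> h W f.
  (* With [W] isomorphic to the shift of [W'], the morphism [f] corresponds to the shift of some [g]
     from [F W'] to [Y]. *)
  have [W' [w iw]] := shift_ess_surj W.
  have [ts' [e1 e2]] := tf_shift_iso F W'.
  have [g hg] := shift_full (f \oc fmor F w \oc ts').
  apply: (iso_precomp_eq0 (is_iso_fmor F iw)).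
  have its : is_iso ts' by exists (tf_shift F W').
  by apply: (iso_precomp_eq0 (f := ts') its); rewrite -hg (h _ g) raddf0.
split=> [Y zY W f|X Y [u [u' [_ e]]] h W f|Y|X Y Z f g k d hX hY W v].
- exact: (zY _).2.
- by rewrite -(comp1m f) -e -compA (h W (u' \oc f)) compm0.
- split=> [|h W f]; first exact: SS.
  apply: shift_faithful; apply: (iso_precomp_eq0 (tf_shift_iso F W)).
  exact: h.
- have [|w ->] := dist_lift (v := v) d; first exact: (SS _ hX).
  by rewrite (hY _ w) compm0.
Qed.

Definition id_fun (C : rcat R) : rfun C C :=
  @RFun R C C id (fun X Y => idfun : {linear hom X Y -> hom X Y})
    (fun=> erefl) (fun _ _ _ _ _ => erefl).

Definition id_trifun (C : tricat R) : trifun C C.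
Proof.
refine (@TriFun R C C (id_fun C) (fun X => idm _) _ _ _).
- by move=> X; exists (idm _); rewrite !comp1m.
- by move=> X Y f /=; rewrite comp1m compm1.
- by move=> X Y Z f g h d /=; rewrite comp1m.
Defined.

Definition comp_fun (C D E : rcat R) (G : rfun D E) (F : rfun C D) : rfun C E.
Proof.
refine (@RFun R C E (fun X => G (F X))
  (fun X Y => (fmor G \o fmor F : {linear hom X Y -> hom _ _})) _ _).
- by move=> X /=; rewrite !fmor1.
- by move=> X Y Z g f /=; rewrite !fmorM.
Defined.

Definition comp_trifun (C D E : tricat R) (G : trifun D E) (F : trifun C D) :
  trifun C E.
Proof.
refine (@TriFun R C E (comp_fun G F)
  (fun X => tf_shift G (F X) \oc fmor G (tf_shift F X)) _ _ _).
- move=> X; apply: is_iso_comp; first exact: tf_shift_iso.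
  exact/is_iso_fmor/tf_shift_iso.
- move=> X Y f /=.
  by rewrite -compA -fmorM tf_shift_nat fmorM compA tf_shift_nat -compA.
- move=> X Y Z f g h d /=; rewrite -compA -fmorM.
  exact/tf_dist/tf_dist.
Defined.

Definition zero_ob (C : tricat R) : C :=
  projT1 (cid (zero_ex (tc_triangulated C))).

Lemma zero_obP (C : tricat R) : is_zero (zero_ob C).
Proof. exact: (projT2 (cid (zero_ex (tc_triangulated C)))). Qed.

(** Serves as the off-diagonal component of the inclusion of a summand. *)
Definition zero_fun (C : rcat R) (D : tricat R) : rfun C D.
Proof.
refine (@RFun R C D (fun=> zero_ob D)
  (fun X Y => (\0 : {linear hom X Y -> hom _ _})) _ _).
- by move=> X; apply/esym/is_zeroP/zero_obP.
- by move=> X Y Z g f /=; rewrite comp0m.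
Defined.

Definition zero_trifun (C D : tricat R) : trifun C D.
Proof.
refine (@TriFun R C D (zero_fun C D) (fun=> 0) _ _ _).
- by move=> X; apply: zero_is_iso; [|apply: is_zero_fob]; exact: zero_obP.
- by move=> X Y f /=; rewrite comp0m compm0.
- by move=> X Y Z f g h _; apply: dist_zero; exact: zero_obP.
Defined.

End Triangulated.

(** * Projections, inclusions and splittings of a direct sum *)

Section DirectSum.
Context {R : comPzRingType} {I : Type}.

Lemma dsum_ext (C : I -> tricat R) (U V : dsum C) (f g : hom U V) :
  (forall i, f i = g i) -> f = g.
Proof. exact: functional_extensionality_dep. Qed.

Definition proj_fun (C : I -> tricat R) (i : I) : rfun (dsum C) (C i).
Proof.
refine (@RFun R (dsum C) (C i) (fun U : dsum C => U i)
  (fun U V => linear_of (f := fun f : hom U V => f i) _) _ _) => //.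
Unshelve. by [].
Defined.

Definition proj_trifun (C : I -> tricat R) (i : I) : trifun (dsum C) (C i).
Proof.
refine (@TriFun R (dsum C) (C i) (proj_fun C i) (fun=> idm _) _ _ _).
- by move=> X; exists (idm _); rewrite !comp1m.
- by move=> X Y f; rewrite comp1m compm1.
- by move=> X Y Z f g h d; rewrite comp1m; exact: d.
Defined.

Section Tuple.
Variables (A : tricat R) (C : I -> tricat R) (F : forall i, trifun A (C i)).
Hypothesis fin : forall X, finite_set (nonzero_at (fun i => F i X)).

(** Objects of the direct sum have finite support, so a family of functors assembles into one
    exactly under [fin]. *)
Definition tuple_fun : rfun A (dsum C).
Proof.
refine (@RFun R A (dsum C) (fun X => DSumOb (fin X))
  (fun X Y => @linear_of R (hom X Y) (dprod (fun i => hom (F i X) (F i Y)))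
     (fun f i => fmor (F i) f) _) _ _).
- by move=> X; apply: dsum_ext => i; exact: fmor1.
- by move=> X Y Z g f; apply: dsum_ext => i; exact: fmorM.
Unshelve.
by move=> a f g; apply: functional_extensionality_dep => i; exact: linearP.
Defined.

Definition tuple_trifun : trifun A (dsum C).
Proof.
refine (@TriFun R A (dsum C) tuple_fun (fun X i => tf_shift (F i) X) _ _ _).
- by move=> X; apply/dsum_isoP => i; exact: tf_shift_iso.
- by move=> X Y f; apply: dsum_ext => i; exact: tf_shift_nat.
- by move=> X Y Z f g h d; exact (fun i => tf_dist (F i) d).
Defined.

End Tuple.

Section Inclusion.
Variable C : I -> tricat R.

(** The decision [s] is an argument so that proofs can generalize over it; the match on the equality
    transports the identity functor to [C k]. *)
Definition incl_at (i k : I) (s : {i = k} + {i <> k}) : trifun (C i) (C k) :=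
  match s with
  | left e => match e in _ = k' return trifun (C i) (C k') with
              | erefl => id_trifun (C i)
              end
  | right _ => zero_trifun (C i) (C k)
  end.

Lemma incl_at_diag i (s : {i = i} + {i <> i}) : incl_at s = id_trifun (C i).
Proof. by case: s => // e; rewrite (Prop_irrelevance e erefl). Qed.

Lemma incl_at_zero i k (s : {i = k} + {i <> k}) (X : C i) :
  i <> k -> is_zero (incl_at s X).
Proof. by case: s => // ? _; exact: zero_obP. Qed.

Lemma incl_fin i (X : C i) :
  finite_set (nonzero_at (fun k => incl_at (pselect (i = k)) X)).
Proof.
apply: sub_finite_set (finite_set1 i) => k nz /=.
by apply: contrapT => ne; apply: nz; apply: incl_at_zero => e; exact: ne.
Qed.

Definition incl i : trifun (C i) (dsum C) :=
  tuple_trifun (@incl_fin i).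

Lemma incl_zero i k (X : C i) : i <> k -> is_zero (incl i X k).
Proof. exact: incl_at_zero. Qed.

Lemma incl_diag i (X : C i) : isomorphic (incl i X i) X.
Proof.
rewrite /= incl_at_diag; exists (idm X), (idm X).
by rewrite comp1m.
Qed.

Lemma incl_faithful i : faithful (incl i).
Proof.
(* Stated for every decision [s], so that [incl_at_diag] can be rewritten before morphisms with
   dependent types appear. *)
have fai (s : {i = i} + {i <> i}) : faithful (incl_at s).
  by rewrite incl_at_diag.
move=> X Y f e; apply: (fai (pselect (i = i))).
exact (congr1 (fun h : hom (incl i X) (incl i Y) => h i) e).
Qed.

Lemma incl_full i : full (incl i).
Proof.
have ful (s : {i = i} + {i <> i}) : full (incl_at s).
  by rewrite incl_at_diag => X Y g; exists g.
move=> X Y g; have [f hf] := ful _ _ _ (g i).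
exists f; apply: dsum_ext => k.
have [e|ne] := pselect (i = k); first by case: k / e.
by rewrite [LHS](incl_zero X ne _).1 [RHS](incl_zero X ne _).1.
Qed.

(** One pair [s], [r] yields both that the [i]-component is a retract of [U] and that it is all of
    [U] when [U] is concentrated in [i]. *)
Lemma incl_component i (U : dsum C) :
  exists (s : hom (incl i (U i)) U) (r : hom U (incl i (U i))),
    r \oc s = idm _ /\
    ((forall k, i <> k -> is_zero (U k)) -> s \oc r = idm _).
Proof.
have H k (d : {i = k} + {i <> k}) :
    exists s : hom (incl_at d (U i)) (U k), exists r : hom (U k) (incl_at d (U i)),
    r \oc s = idm _ /\ ((i <> k -> is_zero (U k)) -> s \oc r = idm _).
  case: d => [e|ne]; first by case: k / e; exists (idm _), (idm _); rewrite comp1m.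
  exists 0, 0; split=> [|/(_ ne)/is_zeroP ->]; last by rewrite comp0m.
  by rewrite comp0m; apply/esym/is_zeroP/zero_obP.
have [s /dep_choice[r h]] := dep_choice (fun k => H k (pselect (i = k))).
exists s, r; split=> [|z]; apply: dsum_ext => k; first exact: (h k).1.
exact: (h k).2 (z k).
Qed.

Lemma incl_retract i (U : dsum C) : is_retract (incl i (U i)) U.
Proof. by have [s [r [e _]]] := incl_component i U; exists s, r. Qed.

Lemma incl_concentrated i (U : dsum C) :
  (forall k, i <> k -> is_zero (U k)) -> isomorphic (incl i (U i)) U.
Proof.
by move=> z; have [s [r [e /(_ z) e']]] := incl_component i U; exists s, r.
Qed.

Lemma is_retract_component (U V : dsum C) k :
  is_retract U V -> is_retract (U k) (V k).
Proof. exact: (is_retract_fob (proj_fun C k)). Qed.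

(** Truncation: [V] keeps the component at [i] and [W] all the others; both have finite support
    because their components are retracts of those of [U]. *)
Lemma dsum_split i (U : dsum C) : exists V W : dsum C,
  [/\ is_biproduct U V W, forall k, i <> k -> is_zero (V k) & is_zero (W i)].
Proof.
have H k : exists V W : C k,
    [/\ is_biproduct (U k) V W, i <> k -> is_zero V & i = k -> is_zero W].
  have [e|ne] := pselect (i = k).
    exists (U k), (zero_ob (C k)); split=> //; last by move=> _; exact: zero_obP.
    exists (idm _), 0, (idm _), 0.
    by rewrite !(comp0m, compm0, comp1m, addr0); split=> //;
      apply/esym/is_zeroP/zero_obP.
  exists (zero_ob (C k)), (U k); split=> //; last by move=> _; exact: zero_obP.
  exists 0, (idm _), 0, (idm _).
  by rewrite !(comp0m, compm0, comp1m, add0r); split=> //;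
    apply/esym/is_zeroP/zero_obP.
have [V /dep_choice[W h]] := dep_choice H.
have fV : finite_set (nonzero_at V).
  apply: sub_finite_set (ds_fin U) => k nz zU; apply: nz.
  have [b _ _] := h k; exact: is_zero_retract (biproduct_retractl b) zU.
have fW : finite_set (nonzero_at W).
  apply: sub_finite_set (ds_fin U) => k nz zU; apply: nz.
  have [b _ _] := h k; exact: is_zero_retract (biproduct_retractr b) zU.
exists (DSumOb fV), (DSumOb fW); split=> [|k|]; last 2 first.
- by case: (h k).
- by have [_ _] := h i; exact.
have b k : is_biproduct (U k) (V k) (W k) by case: (h k).
have [i1 /dep_choice[i2 /dep_choice[p1 /dep_choice[p2 e]]]] := dep_choice b.
by exists i1, i2, p1, p2; split; apply: dsum_ext => k; case: (e k).
Qed.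

Lemma dsum_extend i (U V : dsum C) (g : hom (U i) (V i)) :
  exists f : hom U V, f i = g.
Proof.
(* Extension by zero. Quantifying over all proofs of [i = k] allows the value at [i] to be read off
   at [erefl]. *)
have H k : exists f : hom (U k) (V k),
    forall e : i = k, ecast k (hom (U k) (V k)) e g = f.
  have [e|ne] := pselect (i = k); last by exists 0 => e; case: ne.
  exists (ecast k (hom (U k) (V k)) e g) => e'.
  by rewrite (Prop_irrelevance e e').
by have [f hf] := dep_choice H; exists f; exact: esym (hf i erefl).
Qed.

End Inclusion.

End DirectSum.

(** * Supports of the images of the summands *)

Section Support.
Context {R : comPzRingType}.

(** Exactness enters only through the kernels in the last hypothesis, so the statement also covers a
    quasi-inverse not known to be exact. *)
Lemma connected_support (Gamma Lambda : Type)
    (C : Gamma -> tricat R) (D : Lambda -> tricat R)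
    (F : rfun (dsum C) (dsum D)) (G : rfun (dsum D) (dsum C)) (i : Gamma) :
  quasi_inverse F G -> connected (C i) ->
  (forall k, triangulated_subcat (fun X : C i => is_zero (F (incl C i X) k))) ->
  exists j, forall (X : C i) k, j <> k -> is_zero (F (incl C i X) k).
Proof.
move=> [[fF uF FG] [fG uG GF]] [nz dec] tri.
(* Passing [Z] back to [C i] through [G] does not enlarge its support. *)
have ret (Z : dsum D) k : is_retract (F (incl C i (G Z i)) k) (Z k).
  apply: is_retract_component.
  apply: is_retract_trans (isomorphic_retract (FG Z)).
  exact/is_retract_fob/incl_retract.
(* Split the image of [X] at [j], then carry the splitting back by [G] and the projection to
   [C i]. *)
have spl j X : exists U V B : C i,
    [/\ forall k, j <> k -> is_zero (F (incl C i U) k),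
        is_zero (F (incl C i V) j), is_biproduct B U V & isomorphic X B].
  have [V [W [b cV cW]]] := dsum_split j (F (incl C i X)).
  exists (G V i), (G W i), (G (F (incl C i X)) i); split.
  - by move=> k ne; apply: is_zero_retract (ret V k) (cV k ne).
  - exact: is_zero_retract (ret W j) cW.
  - exact: (is_biproduct_fob (proj_fun C i) (is_biproduct_fob G b)).
  - apply: isomorphic_trans (isomorphic_sym (incl_diag X)) _.
    exact (isomorphic_fob (proj_fun C i) (isomorphic_sym (GF (incl C i X)))).
have [X0 nzX0] : exists X : C i, ~ is_zero X.
  apply: contrapT => h; apply: nz => X; apply: contrapT => hX; apply: h.
  by exists X.
have [j nzj] : exists j, ~ is_zero (F (incl C i X0) j).
  apply: contrapT => h; apply: nzX0.
  apply: (faithful_is_zero (@incl_faithful R Gamma C i)).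
  apply: (faithful_is_zero fF).
  apply/dsum_zeroP => k; apply: contrapT => hk; apply: h; by exists k.
exists j.
(* Objects whose images have disjoint supports are orthogonal, as [F] and the inclusion are
   faithful. *)
have orth (U V : C i) :
    (forall k, is_zero (F (incl C i U) k) \/ is_zero (F (incl C i V) k)) ->
    forall f : hom U V, f = 0.
  move=> z f; apply: incl_faithful; apply: fF; apply: dsum_ext => k.
  by case: (z k) => zk; [exact: (zk _).1|exact: (zk _).2].
case: (dec _ _ (triangulated_subcat_bigcap (fun k => j <> k) tri) (tri j)).
- split=> [|U V PU QV]; first exact: spl.
  by split; apply: orth => k; have [e|ne] := pselect (j = k);
    [right|left|left|right]; rewrite -?e //; exact: PU.
(* If the part concentrated in [j] is trivial, [X0] is a retract of an object whose image vanishes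
   at [j], against the choice of [j]. *)
- move=> PZ; have [U [V [B [PU QV b X0B]]]] := spl j X0.
  case: nzj; apply: is_zero_retract QV.
  apply: is_retract_component; do 2 apply: is_retract_fob.
  apply: is_retract_trans (isomorphic_retract X0B) _.
  exact: biproduct_zerol (PZ _ PU) b.
- move=> QZ X k ne; have [U [V [B [PU QV b XB]]]] := spl j X.
  apply: is_zero_retract (PU k ne).
  apply: is_retract_component; do 2 apply: is_retract_fob.
  apply: is_retract_trans (isomorphic_retract XB) _.
  exact: biproduct_zeror (QZ _ QV) b.
Qed.

(** Any [X] in [C i] is recovered by [G] from an object concentrated in [pi i], so it lives in
    [sigma (pi i)]; were this not [i], all of [C i] would vanish. *)
Lemma support_inverse (Gamma Lambda : Type)
    (C : Gamma -> tricat R) (D : Lambda -> tricat R)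
    (F : rfun (dsum C) (dsum D)) (G : rfun (dsum D) (dsum C))
    (pi : Gamma -> Lambda) (sigma : Lambda -> Gamma) :
  quasi_inverse F G -> (forall i, connected (C i)) ->
  (forall i (X : C i) k, pi i <> k -> is_zero (F (incl C i X) k)) ->
  (forall j (Y : D j) k, sigma j <> k -> is_zero (G (incl D j Y) k)) ->
  cancel pi sigma.
Proof.
move=> [_ [_ _ GF]] hC hpi hsigma i; apply: contrapT => ne.
have [nz _] := hC i; apply: nz => X.
apply: is_zero_retract (hsigma (pi i) (F (incl C i X) (pi i)) i ne).
apply: is_retract_trans (isomorphic_retract (isomorphic_sym (incl_diag X))) _.
apply: is_retract_component; apply: isomorphic_retract.
apply: isomorphic_trans (isomorphic_sym (GF _)) _.
apply/isomorphic_fob/isomorphic_sym/incl_concentrated.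
exact: hpi.
Qed.

Lemma triangulated_subcat_kernel (Gamma Lambda : Type)
    (C : Gamma -> tricat R) (D : Lambda -> tricat R)
    (F : trifun (dsum C) (dsum D)) (i : Gamma) (k : Lambda) :
  triangulated_subcat (fun X : C i => is_zero (F (incl C i X) k)).
Proof.
exact: (triangulated_subcat_preim
  (comp_trifun (proj_trifun D k) (comp_trifun F (incl C i)))
  (triangulated_subcat_zero (D k))).
Qed.

(** As [F] is fully faithful, morphisms from the image of [W] in [C i] to [Y] correspond to
    morphisms from [W] to the [i]-component of [G Y]; the kernel is thus a right orthogonal, defined
    through the exact [F] alone. *)
Lemma triangulated_subcat_inverse_kernel (Gamma Lambda : Type)
    (C : Gamma -> tricat R) (D : Lambda -> tricat R)
    (F : trifun (dsum C) (dsum D)) (G : rfun (dsum D) (dsum C))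
    (i : Gamma) (j : Lambda) :
  quasi_inverse F G ->
  triangulated_subcat (fun Y : D j => is_zero (G (incl D j Y) i)).
Proof.
move=> [[fF uF FG] [fG uG GF]].
have := triangulated_subcat_preim (incl D j)
  (triangulated_subcat_orth (comp_trifun F (incl C i))).
congr triangulated_subcat; apply/funext => Y; apply/propext.
have [u iu] := FG (incl D j Y); have [u' [e e']] := iu.
split=> [h|z W f].
- have [s [r [rs _]]] := incl_component i (G (incl D j Y)).
  (* The inclusion of the [i]-component corresponds under [F] and [u] to a morphism killed by
     orthogonality. *)
  have s0 : s = 0.
    by apply: fF; apply: (iso_postcomp_eq0 iu); exact: h.
  apply: (faithful_is_zero (@incl_faithful R Gamma C i)).
  by apply/is_zeroP; rewrite -rs s0 compm0.
- have [g hg] := uF _ _ (u' \oc f).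
  (* At [i] the target of [g] is zero, elsewhere its source is. *)
  have g0 : g = 0.
    apply: dsum_ext => k; have [ek|ne] := pselect (i = k).
      by case: k / ek; exact: (z _).2.
    exact: (incl_zero W ne _).1.
  by rewrite -(comp1m f) -e' -compA -hg g0 raddf0 compm0.
Qed.

End Support.

Theorem theorem1p2 (R : comPzRingType) (Gamma Lambda : Type)
  (C : Gamma -> tricat R) (D : Lambda -> tricat R)
  (hC : forall i : Gamma, connected (C i))
  (hD : forall j : Lambda, connected (D j))
  (Phi : trifun (dsum C) (dsum D)) (hPhi : is_equivalence Phi) :
  exists pi : Gamma -> Lambda, bijective pi /\
    forall i : Gamma, exists F : trifun (C i) (D (pi i)), is_equivalence F.
Proof.
have [G FG] := equivalence_quasi_inverse hPhi.
have [pi hpi] := choice (fun i => connected_support FG (hC i)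
  (triangulated_subcat_kernel Phi i)).
have [sigma hsigma] := choice (fun j => connected_support
  (quasi_inverse_sym FG) (hD j)
  (fun i => triangulated_subcat_inverse_kernel i j FG)).
have sp := support_inverse FG hC hpi hsigma.
have ps := support_inverse (quasi_inverse_sym FG) hD hsigma hpi.
exists pi; split=> [|i]; first by exists sigma.
have [[fF uF FGid] _] := FG.
exists (comp_trifun (proj_trifun D (pi i)) (comp_trifun Phi (incl C i))).
apply: fully_faithful_equivalence => [X X' f e|X X' g|Y].
- apply: incl_faithful; apply: fF; apply: dsum_ext => k.
  (* Away from [pi i] the image of [X] is zero, so the component at [pi i] determines the whole
     morphism. *)
  have [ek|ne] := pselect (pi i = k); first by case: k / ek; exact: e.
  exact: (hpi i X k ne _).1.
- have [h hg] := dsum_extend (U := Phi (incl C i X)) (V := Phi (incl C i X')) g.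
  have [f' hf'] := uF _ _ h; have [f hf] := incl_full f'.
  by exists f; rewrite -hg -hf' -hf.
(* Since [sigma (pi i)] is [i], the object [G (incl D (pi i) Y)] is concentrated in [i], and its
   [i]-component is a preimage of [Y]. *)
- exists (G (incl D (pi i) Y) i).
  apply: isomorphic_trans (incl_diag Y).
  have h : isomorphic (Phi (incl C i (G (incl D (pi i) Y) i))) (incl D (pi i) Y).
    apply: isomorphic_trans (FGid _).
    apply/isomorphic_fob/incl_concentrated => k ne.
    by apply: hsigma; rewrite sp.
  exact (isomorphic_fob (proj_fun D (pi i)) h).
Qed.
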